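(* Let $\mathcal{H}$ be a real Hilbert space, let $\phi:\mathcal{H}\to\mathbb{R}$ be convex and continuous, and let the operators $U_1,\dots,U_m$, the number $\rho_U$, the string-averaging operators $T_{(\Omega_k,\omega_k)}$ ($k\in\mathbb{N}$), the set $I$, the sets $C_T$ ($T\in I$), the set $C$ and the set $C_{\min}:=\mathrm{Argmin}\{\phi(x)\mid x\in C\}$ be as defined in the context. Let $y^0\in\mathcal{H}$ and assume that the sequence $\{T_{(\Omega_k,\omega_k)}\}_{k=0}^\infty$ is $\limsup$-admissible. Suppose also that each $T\in I$ is approximately shrinking and the family $\{C_T\}_{T\in I}$ is boundedly regular. Then any sequence $\{y^k\}_{k=0}^\infty$ generated by the superiorized GDSA algorithm (described in the context) from $y^0$ with respect to $\phi$ and a sequence $\{\lambda_k\}_{k=0}^\infty\subset[\varepsilon,1+\rho_U-\varepsilon]$, where $\varepsilon>0$, converges strongly to a point $y\in C$, and exactly one of the following two alternatives holds: (i) $y\in C_{\min}$; (ii) $y\notin C_{\min}$ and there exists $k_0\in\mathbb{N}$ such that $\{y^k\}_{k=k_0}^\infty$ is strictly Fejér monotone with respect to $C_{\min}$; namely, there exists a sequence $\{u_k\}_{k=k_0}^\infty$ of positive real numbers such that for every $z\in C_{\min}$, $\|y^{k+1}-z\|^2\le\|y^k-z\|^2-u_k$ for all natural $k\ge k_0$.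
   Context: $\mathbb{N}=\{0,1,2,\dots\}$; $Id$ is the identity on the real Hilbert space $\mathcal{H}$; $\mathrm{Fix}\,T=\{x\in\mathcal{H}: T(x)=x\}$; $d(x,A)=\inf_{y\in A}\|x-y\|$; $\partial\phi(x)=\{g\in\mathcal{H}:\langle g,y-x\rangle\le\phi(y)-\phi(x)\ \text{for all } y\in\mathcal{H}\}$ (nonempty for every $x$ when $\phi$ is convex and continuous). $C_{\min}$ is the (possibly empty) set of minimizers of $\phi$ over $C$. Operators. An operator $T:\mathcal{H}\to\mathcal{H}$ is firmly nonexpansive if $\langle T(x)-T(y),x-y\rangle\ge\|T(x)-T(y)\|^2$ for all $x,y\in\mathcal{H}$. For $\lambda\in[0,2]$, the $\lambda$-relaxation of $T$ is $T_\lambda:=(1-\lambda)Id+\lambda T$. An operator is $\lambda$-relaxed firmly nonexpansive if it is the $\lambda$-relaxation of a firmly nonexpansive operator. An operator $T$ is quasi-nonexpansive if $\|T(x)-z\|\le\|x-z\|$ for all $x\in\mathcal{H}$, $z\in\mathrm{Fix}\,T$. A quasi-nonexpansive operator $T$ is approximately shrinking if for each bounded sequence $\{x^k\}$ in $\mathcal{H}$, $\lim_k\|T(x^k)-x^k\|=0$ implies $\lim_k d(x^k,\mathrm{Fix}\,T)=0$. String-averaging setting. Let $m$ be a positive integer and, for $i=1,\dots,m$, let $\alpha_i\in(0,2]$ and let $U_i:\mathcal{H}\to\mathcal{H}$ be $\alpha_i$-relaxed firmly nonexpansive. Let $\{q_k\}_{k=0}^\infty$ be a bounded sequence of positive integers,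 $\mathcal{M}:=\max_{k}q_k$, and $$\rho_U:=\min\Big\{\mathcal{M}^{-1}\min_{1\le i\le m}(2-\alpha_i)\alpha_i^{-1},\,1\Big\}.$$ For each $k\in\mathbb{N}$ let $\Omega_k$ be a nonempty set of functions from $\{1,\dots,q_k\}$ to $\{1,\dots,m\}$, let $\omega_k:\Omega_k\to(0,1]$ satisfy $\sum_{t\in\Omega_k}\omega_k(t)=1$, and set, for $t\in\Omega_k$, $V_k[t]:=U_{t(q_k)}\cdots U_{t(2)}U_{t(1)}$ (composition) and $T_{(\Omega_k,\omega_k)}:=\sum_{t\in\Omega_k}\omega_k(t)V_k[t]$. Put $$I:=\limsup_{k\to\infty}\{T_{(\Omega_k,\omega_k)}\}=\bigcap_{n=0}^\infty\bigcup_{k=n}^\infty\{T_{(\Omega_k,\omega_k)}\},$$ i.e. the set of operators equal to $T_{(\Omega_k,\omega_k)}$ for infinitely many $k$; $C_T:=\mathrm{Fix}\,T$ for $T\in I$; and $C:=\bigcap_{T\in I}C_T$. A sequence $\{T_k\}_{k=0}^\infty$ of operators $T_k:\mathcal{H}\to\mathcal{H}$ is $\limsup$-admissible if every $T_k$ belongs to $\limsup_{k\to\infty}\{T_k\}$ and for each $T\in\limsup_{k\to\infty}\{T_k\}$ there is an integer $M_T>0$ such that $T\in\{T_k,T_{k+1},\dots,T_{k+M_T-1}\}$ for all $k\in\mathbb{N}$. Bounded regularity. A family $\{C_i\}_{i\in J}$ ($J\ne\emptyset$) of nonempty, closed and convex subsets of $\mathcal{H}$ with nonempty intersection $D$ is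 boundedly regular if for any bounded sequence $\{x^k\}$ in $\mathcal{H}$, $\lim_k d(x^k,C_i)=0$ for each $i\in J$ implies $\lim_k d(x^k,D)=0$. (Nonemptiness of the intersection is part of the definition.) Superiorized GDSA algorithm. Given $y^0\in\mathcal{H}$, a sequence $\{N_k\}_{k=0}^\infty$ of positive integers, positive numbers $\lambda_k$ ($k\in\mathbb{N}$), and positive reals $\beta_{k,n}$ ($k\in\mathbb{N}$, $1\le n\le N_k$) with $\sum_{k=0}^\infty\sum_{n=1}^{N_k}\beta_{k,n}<\infty$, the algorithm is, for each $k\in\mathbb{N}$, $$y^{k+1}:=w^k+\lambda_k\left(T_{(\Omega_k,\omega_k)}(w^k)-w^k\right),\qquad w^k:=y^k+\sum_{n=1}^{N_k}\beta_{k,n}v^{k,n},$$ where for $n=0,1,\dots,N_k-1$, with $y^{k,n}:=y^k+\sum_{i=1}^n\beta_{k,i}v^{k,i}$ (empty sum $=0$) and $s^{k,n}$ a selection from $\partial\phi(y^{k,n})$, one sets $v^{k,n+1}:=-\|s^{k,n}\|^{-1}s^{k,n}$ if $0\notin\partial\phi(y^{k,n})$ and $v^{k,n+1}:=0$ if $0\in\partial\phi(y^{k,n})$. *)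

(* Defs.v *)
From HB Require Import structures.
From mathcomp Require Import all_boot all_order all_algebra.
From mathcomp Require Import all_classical all_reals all_analysis.

Set Implicit Arguments.
Unset Strict Implicit.
Unset Printing Implicit Defensive.

Import Order.TTheory GRing.Theory Num.Theory.
Import numFieldNormedType.Exports.

Local Open Scope classical_set_scope.
Local Open Scope ring_scope.

(* The default value x0 is returned only when the extremum does not exist. *)
Definition set_max (disp : Order.disp_t) (T : porderType disp) (x0 : T)
    (A : set T) : T :=
  xget x0 (A `&` ubound A).

Definition set_min (disp : Order.disp_t) (T : porderType disp) (x0 : T)
    (A : set T) : T :=
  xget x0 (A `&` lbound A).

Section Operators.
Context {R : realType} {H : completeNormedModType R}.

Definition Fix (T : H -> H) : set H := [set x | T x = x].

(* Extended-real valued: the distance to the empty set is +oo. *)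
Definition dist_to (A : set H) (x : H) : \bar R :=
  ereal_inf [set `|x - y|%:E | y in A].

Definition firmly_nonexpansive (dot : {dot H for idfun}) (T : H -> H) : Prop :=
  forall x y : H, `|T x - T y| ^+ 2 <= dot (T x - T y) (x - y).

Definition relaxation (lambda : R) (T : H -> H) : H -> H :=
  fun x => (1 - lambda) *: x + lambda *: T x.

Definition relaxed_firmly_nonexpansive (dot : {dot H for idfun}) (lambda : R)
    (T : H -> H) : Prop :=
  exists2 S : H -> H, firmly_nonexpansive dot S & T = relaxation lambda S.

Definition quasi_nonexpansive (T : H -> H) : Prop :=
  forall x z : H, Fix T z -> `|T x - z| <= `|x - z|.

Definition approximately_shrinking (T : H -> H) : Prop :=
  quasi_nonexpansive T /\
  forall x : nat -> H, bounded_fun x ->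
    `|T (x k) - x k| @[k --> \oo] --> (0 : R) ->
    dist_to (Fix T) (x k) @[k --> \oo] --> 0%E.

Definition boundedly_regular (J : Type) (I : set J) (C : J -> set H) : Prop :=
  [/\ I !=set0,
      forall i, I i -> [/\ C i !=set0, closed (C i) & convex_set (C i)],
      \bigcap_(i in I) C i !=set0 &
      forall x : nat -> H, bounded_fun x ->
        (forall i, I i -> dist_to (C i) (x k) @[k --> \oo] --> 0%E) ->
        dist_to (\bigcap_(i in I) C i) (x k) @[k --> \oo] --> 0%E].

Definition limsup_ops (T : nat -> H -> H) : set (H -> H) :=
  lim_sup_set (fun k => [set T k]).

Definition limsup_admissible (T : nat -> H -> H) : Prop :=
  (forall k, limsup_ops T (T k)) /\
  forall S, limsup_ops T S ->
    exists2 M : nat, (0 < M)%N &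
      forall k, exists2 j : nat, (k <= j < k + M)%N & S = T j.

Definition subdifferential (dot : {dot H for idfun}) (phi : H -> R) (x : H) :
    set H :=
  [set g | forall y : H, dot g (y - x) <= phi y - phi x].

Definition argmin (phi : H -> R) (C : set H) : set H :=
  [set x | C x /\ forall y, C y -> phi x <= phi y].

Definition strictly_Fejer_from (k0 : nat) (y : nat -> H) (A : set H) : Prop :=
  exists2 u : nat -> R,
    forall k, (k0 <= k)%N -> 0 < u k &
    forall z, A z -> forall k, (k0 <= k)%N ->
      `|y k.+1 - z| ^+ 2 <= `|y k - z| ^+ 2 - u k.

(* A string t is a map from 'I_q to 'I_m; foldl applies U (t 0) first, hence
   this is the composition U_{t(q)} \o ... \o U_{t(1)} in 1-based notation. *)
Definition string_op (m q : nat) (U : 'I_m -> H -> H)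
    (t : {ffun 'I_q -> 'I_m}) : H -> H :=
  fun x => foldl (fun z i => U (t i) z) x (enum 'I_q).

Definition string_average (m q : nat) (U : 'I_m -> H -> H)
    (Omega : {set {ffun 'I_q -> 'I_m}}) (omega : {ffun 'I_q -> 'I_m} -> R) :
    H -> H :=
  fun x => \sum_(t in Omega) omega t *: string_op U t x.

(* beta k and v k are indexed from 1 to N k; only those entries are used. *)
Definition inner_iterate (y : nat -> H) (beta : nat -> nat -> R)
    (v : nat -> nat -> H) (k n : nat) : H :=
  y k + \sum_(1 <= i < n.+1) beta k i *: v k i.

Definition superiorized_sequence (dot : {dot H for idfun}) (phi : H -> R)
    (T : nat -> H -> H) (N : nat -> nat) (lambda : nat -> R)
    (beta : nat -> nat -> R) (y0 : H) (y : nat -> H) : Prop :=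
  y 0%N = y0 /\
  exists v s : nat -> nat -> H,
    (forall k n, (n < N k)%N ->
      let D := subdifferential dot phi (inner_iterate y beta v k n) in
      [/\ D (s k n),
          ~ D 0 -> v k n.+1 = - (`|s k n|^-1 *: s k n) &
          D 0 -> v k n.+1 = 0]) /\
    (forall k,
      let w := inner_iterate y beta v k (N k) in
      y k.+1 = w + lambda k *: (T k w - w)).

End Operators.

Definition rho_U (R : realType) (m : nat) (alpha : 'I_m -> R) (q : nat -> nat) :
    R :=
  Num.min ((set_max 0%N (range q))%:R^-1 *
           set_min 0 (range (fun i : 'I_m => (2 - alpha i) * (alpha i)^-1)))
          1.

(* Main.v *)
(* With [d = (x - T x) - (y - T y)], the inequality
   [(1 + rho) |d|^2 <= 2 <x - y, d>] holds for an alpha-relaxed firmly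
   nonexpansive map with [rho = (2 - alpha) / alpha], survives convex
   combinations, and composing q maps divides [rho] by q. Hence every
   string-averaging operator satisfies it with [rho_U], and the relaxed step
   decreases the squared distance to C by [eps^2 |T_k w - w|^2].
   The perturbations being summable, (y^k) is quasi-Fejer with respect to C,
   so the residuals [|T_k w^k - w^k|] tend to 0; since every T in I recurs
   within a bounded number of steps, [|T y^k - y^k|] tends to 0 as well, and
   approximate shrinking with bounded regularity give [d(y^k, C) -> 0], which
   turns quasi-Fejer monotonicity into strong convergence.
   If the limit is not a minimizer, then near it each normalized subgradient
   step of length beta decreases the squared distance to every minimizer by at
   least [r beta], for a fixed r > 0. *)
Require Import Defs.
From HB Require Import structures.
From mathcomp Require Import all_boot all_order all_algebra.
From mathcomp Require Import all_classical all_reals all_analysis.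

From mathcomp Require Import ring lra.

Set Implicit Arguments.
Unset Strict Implicit.
Unset Printing Implicit Defensive.

Import Order.TTheory GRing.Theory Num.Theory.
Import numFieldNormedType.Exports.

Local Open Scope classical_set_scope.
Local Open Scope ring_scope.

(** * Cocoercivity of the displacement [Id - T] under relaxation, composition and averaging *)

Section Displacement.
Context (R : realType) (H : completeNormedModType R) (dot : {dot H for idfun}).
Hypothesis dot_norm : forall x : H, dot x x = `|x| ^+ 2.

Lemma dot_sym (x y : H) : dot x y = dot y x.
Proof. by rewrite hermC expr0 mul1r. Qed.

Lemma sqr_normD (x y : H) :
  `|x + y| ^+ 2 = `|x| ^+ 2 + 2 * dot x y + `|y| ^+ 2.
Proof. by rewrite -!dot_norm linearDl /= !linearDr /= (dot_sym y x); ring. Qed.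

Lemma dotZl (a : R) (x y : H) : dot (a *: x) y = a * dot x y.
Proof. exact: linearZl_LR. Qed.

Lemma dotZr (a : R) (x y : H) : dot x (a *: y) = a * dot x y.
Proof. exact: linearZr_LR. Qed.

Definition displacement (T : H -> H) (x y : H) : H := (x - T x) - (y - T y).

(** For [rho = 0] this is nonexpansiveness of [T], for [rho = 1] firm nonexpansiveness; in general
    [Id - T] is cocoercive with constant [(1 + rho) / 2]. *)
Definition displacement_cocoercive (rho : R) (T : H -> H) : Prop :=
  forall x y, (1 + rho) * `|displacement T x y| ^+ 2
    <= 2 * dot (x - y) (displacement T x y).


Lemma subr_displacement T x y : T x - T y = (x - y) - displacement T x y.
Proof. by rewrite /displacement opprB addrA subrKA opprB addrC subrKA. Qed.

Lemma sqr_normZ (a : R) (x : H) : `|a *: x| ^+ 2 = a ^+ 2 * `|x| ^+ 2.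
Proof. by rewrite normrZ exprMn real_normK ?num_real. Qed.

Lemma sqr_normB (x y : H) :
  `|x - y| ^+ 2 = `|x| ^+ 2 - 2 * dot x y + `|y| ^+ 2.
Proof. by rewrite sqr_normD normrN linearNr mulrN. Qed.

(** Relaxation multiplies the displacement by [alpha], and firm nonexpansiveness of [S] amounts to
    [|d|^2 <= <x - y, d>] for its displacement [d]. *)
Lemma relaxed_displacement_cocoercive (alpha : R) (T : H -> H) :
  0 < alpha -> relaxed_firmly_nonexpansive dot alpha T ->
  displacement_cocoercive ((2 - alpha) * alpha^-1) T.
Proof.
move=> a0 [S fneS ->] x y.
have -> : displacement (relaxation alpha S) x y = alpha *: displacement S x y.
  rewrite /displacement /relaxation !scalerBl !scale1r !scalerBr.
  have e (u a b : H) : u - (u - a + b) = a - b.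
    by rewrite opprD opprB addrA subrKC.
  by rewrite !e.
have := fneS x y.
rewrite subr_displacement [dot _ _]linearBl /= sqr_normB dot_norm dotZr sqr_normZ.
rewrite (dot_sym (displacement S x y)) => h.
have -> : (1 + (2 - alpha) / alpha) * (alpha ^+ 2 * `|displacement S x y| ^+ 2)
  = 2 * (alpha * `|displacement S x y| ^+ 2) by field; rewrite gt_eqF.
rewrite ler_pM2l// ler_pM2l//; lra.
Qed.

(** Induction on the string: displacements add up, the second one being taken at the images under
    the first map. The inequality is kept multiplied by the length, so that it makes sense for the
    empty string. *)
Lemma foldl_displacement (J : Type) (f : J -> H -> H) (rho : R) (s : seq J) :
  0 <= rho -> (forall j, displacement_cocoercive rho (f j)) ->
  let V := fun x => foldl (fun z j => f j z) x s in
  forall x y, ((size s)%:R + rho) * `|displacement V x y| ^+ 2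
    <= 2 * (size s)%:R * dot (x - y) (displacement V x y).
Proof.
move=> rho0 ff; elim: s => [|j s IH] /= x y.
  by rewrite /displacement !subrr normr0 expr0n/= !mulr0 mul0r.
set V := fun x => foldl _ x s in IH *.
have -> : displacement (fun x0 => foldl (fun z j0 => f j0 z) (f j x0) s) x y
   = displacement (f j) x y + displacement V (f j x) (f j y).
  rewrite /displacement -/(V (f j x)) -/(V (f j y)).
  by rewrite addrACA -opprD addrA subrK addrA subrK.
have h2 := ff j x y; have h3 := IH (f j x) (f j y).
rewrite subr_displacement [dot _ _]linearBl /= in h3.
rewrite [dot _ _]linearDr /= sqr_normD -[(size s).+1%:R]natr1.
set d1 := displacement (f j) x y in h2 h3 *.
set d2 := displacement V _ _ in h3 *.
set n : R := (size s)%:R in h3 *.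
have n0 : 0 <= n by rewrite /n ler0n.
set p := dot _ d1 in h2 *; set r := dot (x - y) d2 in h3 *; set t := dot d1 d2 in h3 *.
(* The general case multiplies the goal by [n], so an empty tail is treated apart. *)
case: (eqVneq n 0) => [n00|nn0].
  have : size s = 0%N by apply/eqP; rewrite -(pnatr_eq0 R) -/n n00.
  move=> /size0nil s0; have d20 : d2 = 0.
    by rewrite /d2 /displacement /V s0 /= !subrr.
  by rewrite /r /t d20 !linear0r normr0 n00; lra.
have := sqr_ge0 (`|n *: d1 - d2|); rewrite sqr_normB sqr_normZ dotZl -/t => h1.
have np : 0 < n by rewrite lt_neqAle eq_sym nn0.
rewrite -(ler_pM2l np).
set P := `|d1| ^+ 2 in h1 h2 *; set Q := `|d2| ^+ 2 in h1 h3 *.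
have k1 := mulr_ge0 rho0 h1.
have k2 : 0 <= n * (n + 1) * (2 * p - (1 + rho) * P).
  by rewrite mulr_ge0 ?subr_ge0// mulr_ge0// ltW// ltr_wpDr.
have k3 : 0 <= (n + 1) * (2 * n * (r - t) - (n + rho) * Q).
  by rewrite mulr_ge0 ?subr_ge0// addr_ge0.
rewrite -subr_ge0.
(* The gap is a sum of three nonnegative terms: the inequality for the first map, the induction
   hypothesis, and [rho] times the square [|n d1 - d2|^2]. *)
have -> : n * (2 * (n + 1) * (p + r)) - n * ((n + 1 + rho) * (P + 2 * t + Q))
 = n * (n + 1) * (2 * p - (1 + rho) * P)
   + (n + 1) * (2 * n * (r - t) - (n + rho) * Q)
   + rho * (n ^+ 2 * P - 2 * (n * t) + Q) by ring.
by rewrite !addr_ge0.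
Qed.

Lemma string_op_displacement_cocoercive (m q M : nat) (U : 'I_m -> H -> H)
    (rho : R) (t : {ffun 'I_q -> 'I_m}) :
  (0 < q <= M)%N -> 0 <= rho ->
  (forall i, displacement_cocoercive rho (U i)) ->
  displacement_cocoercive (M%:R^-1 * rho) (string_op U t).
Proof.
move=> /andP[q0 qM] rho0 UU x y.
have := foldl_displacement (enum 'I_q) rho0 (fun j => UU (t j)) x y.
rewrite size_enum_ord -/(string_op U t).
set D := displacement _ x y.
have qp : 0 < q%:R :> R by rewrite ltr0n.
move=> h; rewrite -(ler_pM2l qp).
apply: le_trans (le_trans _ h) _; last by rewrite mulrCA mulrA.
rewrite mulrA ler_wpM2r ?sqr_ge0//.
rewrite mulrDr mulr1 lerD2l mulrA ler_piMl//.
by rewrite ler_pdivrMr ?mul1r ?ler_nat// ltr0n (leq_trans q0).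
Qed.

(** The right side is linear in the displacement and the left side convex, since [1 + rho >= 0];
    weights summing to 1 therefore preserve the inequality. *)
Lemma string_average_displacement_cocoercive (m q : nat) (U : 'I_m -> H -> H)
    (rho : R) (Omega : {set {ffun 'I_q -> 'I_m}})
    (omega : {ffun 'I_q -> 'I_m} -> R) :
  -1 <= rho ->
  (forall t, t \in Omega -> 0 <= omega t) -> \sum_(t in Omega) omega t = 1 ->
  (forall t : {ffun 'I_q -> 'I_m}, displacement_cocoercive rho (string_op U t)) ->
  displacement_cocoercive rho (string_average U Omega omega).
Proof.
move=> rho1 om0 om1 VV x y.
set D := fun t : {ffun 'I_q -> 'I_m} => displacement (string_op U t) x y.
have -> : displacement (string_average U Omega omega) x y
    = \sum_(t in Omega) omega t *: D t.
  rewrite /displacement /string_average.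
  have e z : z - \sum_(t in Omega) omega t *: string_op U t z
    = \sum_(t in Omega) omega t *: (z - string_op U t z).
    rewrite -{1}(scale1r z) -om1 scaler_suml -sumrB.
    by apply: eq_bigr => t _; rewrite scalerBr.
  by rewrite !e -sumrB; apply: eq_bigr => t _; rewrite -scalerBr.
set a := \sum_(t in Omega) _.
have dotsum z : dot z a = \sum_(t in Omega) omega t * dot z (D t).
  by rewrite /a linear_sumr /=; apply: eq_bigr => t _; rewrite dotZr.
have a_le : `|a| ^+ 2 <= \sum_(t in Omega) omega t * `|D t| ^+ 2.
  (* The weighted variance of the [D t] is nonnegative, which is Jensen's inequality for the squared
     norm. *)
  have : 0 <= \sum_(t in Omega) omega t * `|a - D t| ^+ 2.
    by apply: sumr_ge0 => t tO; rewrite mulr_ge0 ?om0 ?sqr_ge0.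
  under eq_bigr do rewrite sqr_normB mulrDr mulrBr [omega _ * (2 * _)]mulrCA.
  rewrite big_split sumrB /= -mulr_sumr -dotsum -mulr_suml om1 dot_norm; lra.
apply: (@le_trans _ _ (\sum_(t in Omega) omega t * ((1 + rho) * `|D t| ^+ 2))).
  under eq_bigr do rewrite mulrCA.
  by rewrite -mulr_sumr; apply: ler_wpM2l a_le; rewrite -lerBlDl sub0r.
rewrite dotsum mulr_sumr; apply: ler_sum => t tO.
by rewrite [leRHS]mulrCA; apply: ler_wpM2l (VV t x y); exact: om0.
Qed.

(** At a fixed point [z] the displacement reduces to [x - T x]; expanding the square leaves a
    quadratic in [lambda]. *)
Lemma relaxation_step_le (lambda rho : R) (T : H -> H) (x z : H) :
  0 <= lambda -> displacement_cocoercive rho T -> T z = z ->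
  `|x + lambda *: (T x - x) - z| ^+ 2
    <= `|x - z| ^+ 2 - lambda * (1 + rho - lambda) * `|T x - x| ^+ 2.
Proof.
move=> l0 /(_ x z); rewrite /displacement => + Tz.
rewrite Tz subrr subr0 => h.
have -> : x + lambda *: (T x - x) - z = (x - z) - lambda *: (x - T x).
  by rewrite addrAC -scalerN opprB.
rewrite sqr_normB sqr_normZ dotZr (distrC (T x)).
have := ler_wpM2l l0 h; nra.
Qed.

Lemma displacement_cocoercive_nonexpansive (rho : R) (T : H -> H) (x y : H) :
  0 <= rho -> displacement_cocoercive rho T -> `|T x - T y| <= `|x - y|.
Proof.
move=> rho0 /(_ x y) h.
rewrite -(@ler_pXn2r _ 2)// ?nnegrE//.
rewrite subr_displacement sqr_normB.
have := mulr_ge0 rho0 (sqr_ge0 (`|displacement T x y|)); lra.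
Qed.

End Displacement.

(** * The extrema in [rho_U] are attained *)

Lemma set_max_nat_ge (A : set nat) (n : nat) :
  has_ubound A -> A n -> (n <= set_max 0 A)%N.
Proof.
move=> [u uA] An.
have exA : exists n, n \in A by exists n; rewrite inE.
have ubA i : i \in A -> (i <= u)%N by rewrite inE => /uA; rewrite leEnat.
have max_ex : exists i, (A `&` ubound A) i.
  case: (ex_maxnP exA ubA) => i; rewrite inE => Ai imax.
  by exists i; split=> // j Aj; rewrite leEnat; apply: imax; rewrite inE.
by have [_ /(_ _ An)] := xgetPex 0%N max_ex; rewrite leEnat.
Qed.

Lemma set_min_rangeP (R : realType) (J : finType) (f : J -> R) (j : J) :
  range f (set_min 0 (range f)) /\ forall i, set_min 0 (range f) <= f i.
Proof.
have min_ex : exists x, (range f `&` lbound (range f)) x.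
  have [i _ imin] := @arg_minP _ _ _ j xpredT f isT.
  by exists (f i); split=> [|_ [l _ <-]]; [exists i|exact: imin].
have [fx xmin] := xgetPex 0 min_ex.
by split=> // i; apply: xmin; exists i.
Qed.

(** * Real sequences that decrease up to a summable error *)

Section QuasiFejer.
Context (R : realType).
Implicit Types a b : R ^nat.

Lemma quasi_fejer_le a b : (forall k, a k.+1 <= a k + b k) ->
  forall k j, (k <= j)%N -> a j <= a k + (series b j - series b k).
Proof.
move=> ab k; elim=> [|j IH]; first by rewrite leqn0 => /eqP->; rewrite subrr addr0.
rewrite leq_eqVlt => /predU1P[->|]; first by rewrite subrr addr0.
rewrite ltnS => /IH h; have := ab j.
have -> : series b j.+1 = series b j + b j by rewrite /series /= big_nat_recr.
lra.
Qed.

Lemma series_le_lim b : (forall k, 0 <= b k) -> cvgn (series b) ->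
  forall k, series b k <= limn (series b).
Proof.
move=> b0 cb; apply: nondecreasing_cvgn_le => //.
by apply: nondecreasing_series => k _ _; exact: b0.
Qed.

Lemma quasi_fejer_is_cvgn a b : (forall k, 0 <= a k) -> (forall k, 0 <= b k) ->
  (forall k, a k.+1 <= a k + b k) -> cvgn (series b) -> cvgn a.
Proof.
move=> a0 b0 ab cb.
(* Subtracting the accumulated errors makes the sequence nonincreasing, and it is bounded below by
   minus the total error. *)
have -> : a = (a \- series b) \+ series b by apply/funext => k /=; rewrite subrK.
apply: is_cvgD => //; apply: nonincreasing_is_cvgn.
  by move=> k j kj /=; have := quasi_fejer_le ab kj; lra.
exists (- limn (series b)) => _ [k _ <-] /=.
by have := series_le_lim b0 cb k; have := a0 k; lra.
Qed.

(** [c * r k ^+ 2] is at most a difference of two squares with the same limit, because [a] converges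
    and [b] tends to 0. *)
Lemma quasi_fejer_residual_cvg0 a b r (c : R) :
  0 < c -> (forall k, 0 <= a k) -> (forall k, 0 <= b k) -> (forall k, 0 <= r k) ->
  cvgn (series b) ->
  (forall k, a k.+1 ^+ 2 <= (a k + b k) ^+ 2 - c * r k ^+ 2) ->
  r k @[k --> \oo] --> 0.
Proof.
move=> c0 a0 b0 r0 cb abr.
have ab k : a k.+1 <= a k + b k.
  rewrite -(@ler_pXn2r _ 2)// ?nnegrE ?addr_ge0//.
  by apply: le_trans (abr k) _; rewrite gerBl mulr_ge0 ?sqr_ge0 ?ltW.
have ca := quasi_fejer_is_cvgn a0 b0 ab cb.
have b_0 := cvg_series_cvg_0 cb.
have cS : (fun k => a k.+1) @ \oo --> limn a by rewrite (cvg_shiftS a).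
have gap0 : (fun k => (a k + b k) ^+ 2 - a k.+1 ^+ 2) @ \oo --> (0 : R).
  have -> : 0 = (limn a + 0) ^+ 2 - limn a ^+ 2 :> R by rewrite addr0 subrr.
  apply: cvgB; first by rewrite expr2; apply: cvgM; apply: cvgD.
  by rewrite expr2; apply: cvgM.
apply/cvgr0Pnorm_lt => e e0.
have ce0 : 0 < c * e ^+ 2 by rewrite mulr_gt0// exprn_gt0.
near=> k.
rewrite ger0_norm// -(@ltr_pXn2r _ 2)// ?nnegrE ?(ltW e0)//.
rewrite -(ltr_pM2l c0).
have : (a k + b k) ^+ 2 - a k.+1 ^+ 2 < c * e ^+ 2.
  by near: k; exact: cvgr_lt gap0 _ ce0.
by apply: le_lt_trans; have := abr k; lra.
Unshelve. all: by end_near. Qed.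

End QuasiFejer.

(** * From vanishing distances and residuals to strong convergence *)

Section DistTo.
Context (R : realType) (H : completeNormedModType R).

Lemma dist_to_cvg0_near (A : set H) (x : nat -> H) :
  dist_to A (x k) @[k --> \oo] --> 0%E ->
  forall e : R, 0 < e -> \forall k \near \oo, exists2 z, A z & `|x k - z| < e.
Proof.
move=> /fine_cvgP[fin cv] e e0.
near=> k.
have dfin : dist_to A (x k) \is a fin_num by near: k.
have : fine (dist_to A (x k)) < e by near: k; exact: cvgr_lt cv _ e0.
rewrite -lte_fin fineK// => /ereal_inf_lt[_ [z Az <-]].
by rewrite lte_fin; exists z.
Unshelve. all: by end_near. Qed.

(** Once an iterate is close to some [z] in [C] and the remaining errors are small, all later
    iterates stay close to [z]; hence the sequence is Cauchy. *)
Lemma quasi_fejer_strong_cvg (C : set H) (b : R ^nat) (y : nat -> H) :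
  closed C -> (forall k, 0 <= b k) -> cvgn (series b) ->
  (forall z, C z -> forall k, `|y k.+1 - z| <= `|y k - z| + b k) ->
  dist_to C (y k) @[k --> \oo] --> 0%E ->
  exists2 x, C x & y k @[k --> \oo] --> x.
Proof.
move=> clC b0 cb fej dC.
have cy : cvgn y.
  apply: cauchy_cvg; apply: cauchy_exP => e e0.
  have e30 : 0 < e / 3 by rewrite divr_gt0.
  have tail : \forall k \near \oo, limn (series b) - e / 3 < series b k.
    by apply: cvgr_gt cb _ _; rewrite ltrBlDr ltrDl.
  (* The three thirds of [e] pay for [|y K - z|] twice and for the tail of the error series once. *)
  have [K _ /(_ _ (leqnn K)) /= [[z Cz yz] bK]] :=
    filterI (dist_to_cvg0_near dC e30) tail.
  exists (y K); exists K => // j /= Kj.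
  have := quasi_fejer_le (fej z Cz) Kj.
  have := series_le_lim b0 cb j.
  have := ler_distD z (y K) (y j); rewrite (distrC z (y j)).
  rewrite -ball_normE /=; lra.
exists (limn y) => //.
apply: clC => B /nbhs_ballP[e /= e0 eB].
have e20 : 0 < e / 2 by rewrite divr_gt0.
have [K _ /(_ _ (leqnn K)) /= [[z Cz yz] yK]] :=
  filterI (dist_to_cvg0_near dC e20) ((cvgrPdist_lt _ _).1 cy _ e20).
exists z; split => //; apply: eB; rewrite -ball_normE /=.
by apply: le_lt_trans (ler_distD (y K) _ _) _; lra.
Qed.

End DistTo.

(** [S] is applied at some [j] fewer than [M] steps after [k], and the iterates drift little in
    between; nonexpansiveness carries the small residual at [w j] back to [y k]. *)
Lemma recurrent_residual_cvg0 (R : realType) (H : completeNormedModType R)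
    (T : nat -> H -> H) (S : H -> H) (M : nat) (w y : nat -> H) :
  (forall x z, `|S x - S z| <= `|x - z|) ->
  (forall k, exists2 j, (k <= j < k + M)%N & S = T j) ->
  `|T k (w k) - w k| @[k --> \oo] --> (0 : R) ->
  `|w k - y k| @[k --> \oo] --> (0 : R) ->
  `|y k.+1 - w k| @[k --> \oo] --> (0 : R) ->
  `|S (y k) - y k| @[k --> \oo] --> (0 : R).
Proof.
move=> neS rec r0 wy0 yw0; apply/cvgr0Pnorm_lt => e e0.
(* Chosen so that [e] is [3 d] plus twice the drift bound [2 M d]. *)
set d := e / (3 + 4 * M%:R).
have den0 : 0 < 3 + 4 * M%:R :> R by rewrite ltr_wpDr// mulr_ge0.
have d0 : 0 < d by rewrite divr_gt0.
have near_d (f : nat -> H) : `|f k| @[k --> \oo] --> (0 : R) ->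
    \forall k \near \oo, `|f k| < d.
  by move=> /cvgr0_norm_lt /(_ _ d0); apply: filterS => k; rewrite normr_id.
have [K _ HK] := filterI (near_d _ r0) (filterI (near_d _ wy0) (near_d _ yw0)).
exists K => // k /= Kk; rewrite normr_id.
have step i : `|y (k + i)%N - y k| <= i%:R * (2 * d).
  elim: i => [|i IH]; first by rewrite addn0 subrr normr0 mul0r.
  have [_ [h1 h2]] := HK (k + i)%N (leq_trans Kk (leq_addr _ _)).
  rewrite addnS -natr1.
  have := ler_distD (w (k + i)%N) (y (k + i).+1) (y (k + i)%N).
  have := ler_distD (y (k + i)%N) (y (k + i).+1) (y k).
  by move: h1 h2 IH; lra.
have [j /andP[kj jM] Sj] := rec k.
have [h0 [h1 _]] := HK j (leq_trans Kk kj).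
have yj : `|y j - y k| <= M%:R * (2 * d).
  rewrite -(subnKC kj); apply: le_trans (step _) _.
  rewrite ler_wpM2r ?ler_nat ?mulr_ge0 ?ltW// leq_subLR; exact: ltnW.
rewrite -Sj in h0.
have := ler_distD (S (w j)) (S (y k)) (y k).
have := ler_distD (w j) (S (w j)) (y k).
have := neS (y k) (w j); rewrite (distrC (y k) (w j)).
have := ler_distD (y j) (w j) (y k).
have : e = 3 * d + 2 * (M%:R * (2 * d)) by rewrite /d; field; rewrite gt_eqF.
by move: h0 h1 yj; lra.
Qed.

(** * String averages with the constant [rho_U], and the size of the perturbations *)

Section Superiorization.
Context (R : realType) (H : completeNormedModType R) (dot : {dot H for idfun}).
Hypothesis dot_norm : forall x : H, dot x x = `|x| ^+ 2.

Lemma displacement_cocoercive_le (rho rho' : R) (T : H -> H) :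
  rho <= rho' -> displacement_cocoercive dot rho' T ->
  displacement_cocoercive dot rho T.
Proof.
by move=> le_rho TT x y; apply: le_trans (TT x y); rewrite ler_wpM2r ?lerD2l ?sqr_ge0.
Qed.

Lemma rho_U_ge0 (m : nat) (alpha : 'I_m -> R) (q : nat -> nat) :
  (0 < m)%N -> (forall i, 0 < alpha i <= 2) -> 0 <= rho_U alpha q.
Proof.
move=> m0 alpha_itv; rewrite /rho_U le_min ler01 andbT mulr_ge0 ?invr_ge0//.
have [[i _ <-] _] :=
  set_min_rangeP (fun i : 'I_m => (2 - alpha i) * (alpha i)^-1) (Ordinal m0).
by have /andP[a0 a2] := alpha_itv i; rewrite mulr_ge0 ?subr_ge0// invr_ge0 ltW.
Qed.

Lemma string_average_rho_U (m : nat) (alpha : 'I_m -> R) (U : 'I_m -> H -> H)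
    (q : nat -> nat) (k : nat) (Omega : {set {ffun 'I_(q k) -> 'I_m}})
    (omega : {ffun 'I_(q k) -> 'I_m} -> R) :
  (0 < m)%N -> (forall i, 0 < alpha i <= 2) ->
  (forall i, relaxed_firmly_nonexpansive dot (alpha i) (U i)) ->
  (0 < q k)%N -> has_ubound (range q) ->
  (forall t, t \in Omega -> 0 <= omega t) -> \sum_(t in Omega) omega t = 1 ->
  displacement_cocoercive dot (rho_U alpha q) (string_average U Omega omega).
Proof.
move=> m0 alpha_itv UU q0 qub om0 om1.
set f := fun i : 'I_m => (2 - alpha i) * (alpha i)^-1.
have [[i _ mini] minf] := set_min_rangeP f (Ordinal m0).
have rho0 := rho_U_ge0 q m0 alpha_itv.
apply: string_average_displacement_cocoercive => //.
  by apply: le_trans rho0; rewrite lerN10.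
(* The strings satisfy the inequality with the first entry of the minimum defining [rho_U], which is
   at least [rho_U]. *)
move=> t; apply: (@displacement_cocoercive_le _
    ((set_max 0%N (range q))%:R^-1 * set_min 0 (range f))); last first.
  apply: string_op_displacement_cocoercive => //.
  - by rewrite q0/= set_max_nat_ge//; exists k.
  - have /andP[a0 a2] := alpha_itv i.
    by rewrite -mini mulr_ge0 ?subr_ge0// invr_ge0 ltW.
  - move=> j; apply: displacement_cocoercive_le (minf j) _.
    by apply: relaxed_displacement_cocoercive => //; have /andP[] := alpha_itv j.
by rewrite /rho_U ge_min lexx.
Qed.

Lemma inner_iterateS (y : nat -> H) (beta : nat -> nat -> R)
    (v : nat -> nat -> H) (k n : nat) :
  inner_iterate y beta v k n.+1
    = inner_iterate y beta v k n + beta k n.+1 *: v k n.+1.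
Proof. by rewrite /inner_iterate big_nat_recr//= addrA. Qed.

Lemma inner_iterate_dist (y : nat -> H) (beta : nat -> nat -> R)
    (v : nat -> nat -> H) (k n : nat) :
  (forall i, (1 <= i <= n)%N -> 0 <= beta k i) ->
  (forall i, (1 <= i <= n)%N -> `|v k i| <= 1) ->
  `|inner_iterate y beta v k n - y k| <= \sum_(1 <= i < n.+1) beta k i.
Proof.
move=> beta0 v1; rewrite /inner_iterate addrC addKr.
apply: le_trans (ler_norm_sum _ _ _) _.
rewrite big_nat_cond [leRHS]big_nat_cond; apply: ler_sum => i.
rewrite andbT ltnS => iN.
by rewrite normrZ (ger0_norm (beta0 _ iN)) ler_piMr ?beta0// v1.
Qed.

(** * Descent along normalized negative subgradients *)

Variable phi : H -> R.

(* Testing the subgradient inequality at [u + (r / |g|) g] bounds [r |g|] by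
   [delta], while testing it at [z] bounds [dot g (u - z)] below by [delta]. *)
Lemma normalized_subgradient_descent (g u z : H) (r delta : R) :
  subdifferential dot phi u g -> 0 < r -> 0 < delta ->
  phi z + delta <= phi u ->
  (forall h, `|h| <= r -> phi (u + h) <= phi u + delta) ->
  r <= dot (`|g|^-1 *: g) (u - z).
Proof.
move=> ug r0 delta0 zu near_u.
have gz : delta <= dot g (u - z).
  by have := ug z; rewrite -opprB linearNr; lra.
have g0 : 0 < `|g|.
  rewrite normr_gt0; apply/eqP => g0; move: gz.
  by rewrite g0 linear0l leNgt delta0.
rewrite dotZl mulrC ler_pdivlMr//; apply: le_trans gz.
have h_r : `|(r / `|g|) *: g| <= r.
  by rewrite normrZ ger0_norm ?divr_ge0 ?(ltW r0)// divfK ?gt_eqF.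
have := near_u _ h_r; have := ug (u + (r / `|g|) *: g).
rewrite addrC addKr dotZr dot_norm expr2 mulrA divfK ?gt_eqF//; lra.
Qed.

(** The first-order gain is [2 r beta], and the second-order term, at most [beta ^+ 2 <= r * beta],
    uses up half of it. *)
Lemma descent_step (u v z : H) (beta r : R) :
  0 <= beta <= r -> `|v| <= 1 -> dot v (u - z) <= - r ->
  `|u + beta *: v - z| ^+ 2 <= `|u - z| ^+ 2 - r * beta.
Proof.
move=> /andP[beta0 beta_r] v1 vz.
rewrite addrAC [leLHS](sqr_normD dot_norm) dotZr sqr_normZ (dot_sym dot (u - z)).
have : beta ^+ 2 * `|v| ^+ 2 <= r * beta.
  rewrite (@le_trans _ _ (beta ^+ 2))//; last by rewrite expr2 ler_wpM2r.
  by rewrite ler_piMr ?sqr_ge0// exprn_ile1.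
have := ler_wpM2l beta0 vz; lra.
Qed.

Variables (T : nat -> H -> H) (N : nat -> nat) (lambda : nat -> R).
Variables (beta : nat -> nat -> R) (y : nat -> H).
Variables (v s : nat -> nat -> H).
Hypothesis beta_gt0 : forall k n, (1 <= n <= N k)%N -> 0 < beta k n.
Hypothesis v_def : forall k n, (n < N k)%N ->
  let D := subdifferential dot phi (inner_iterate y beta v k n) in
  [/\ D (s k n), ~ D 0 -> v k n.+1 = - (`|s k n|^-1 *: s k n) &
      D 0 -> v k n.+1 = 0].

Lemma direction_norm_le1 k i : (1 <= i <= N k)%N -> `|v k i| <= 1.
Proof.
case: i => // n /= nN; have [_ vD vD0] := v_def nN.
have [D0|D0] := pselect (subdifferential dot phi (inner_iterate y beta v k n) 0).
  by rewrite vD0// normr0.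
rewrite vD// normrN normrZ ger0_norm ?invr_ge0//.
by have [->|s0] := eqVneq (s k n) 0; rewrite ?normr0 ?mulr0// mulVf ?normr_eq0.
Qed.

Lemma inner_iterate_dist_le k n : (n <= N k)%N ->
  `|inner_iterate y beta v k n - y k| <= \sum_(1 <= i < (N k).+1) beta k i.
Proof.
move=> nN; have n_lt i : (1 <= i <= n)%N -> (1 <= i <= N k)%N.
  by case/andP=> -> /= /leq_trans; apply.
apply: le_trans (inner_iterate_dist _ _ _) _ => [i /n_lt iN|i /n_lt|].
- exact/ltW/beta_gt0.
- exact: direction_norm_le1.
rewrite [leRHS](@big_cat_nat _ _ _ n.+1)//= lerDl.
rewrite big_nat_cond sumr_ge0// => i /andP[/andP[ni iN] _].
by apply/ltW/beta_gt0; rewrite (leq_trans _ ni).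
Qed.

Lemma beta_le_sum k i : (1 <= i <= N k)%N ->
  beta k i <= \sum_(1 <= j < (N k).+1) beta k j.
Proof.
move=> iN; rewrite (bigD1_seq i) ?mem_index_iota ?iota_uniq//= lerDl.
rewrite big_seq_cond sumr_ge0// => j /andP[]; rewrite mem_index_iota => jN _.
exact/ltW/beta_gt0.
Qed.

(** An inner iterate [u] within [r] of [x] has its whole [r]-ball inside the [2 r]-ball of [x].
    There [phi] exceeds [phi z + delta] and oscillates by less than [delta], so every step gains [r]
    times its length. *)
Lemma inner_descent (k n : nat) (x z : H) (r delta : R) :
  (n <= N k)%N -> 0 < r -> 0 < delta -> phi x = phi z + 2 * delta ->
  (forall u, `|x - u| < 2 * r -> `|phi x - phi u| < delta / 2) ->
  (forall i, (i < n)%N -> `|x - inner_iterate y beta v k i| < r) ->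
  (forall i, (1 <= i <= n)%N -> beta k i <= r) ->
  `|inner_iterate y beta v k n - z| ^+ 2
    <= `|y k - z| ^+ 2 - r * \sum_(1 <= i < n.+1) beta k i.
Proof.
move=> + r0 delta0 phixz near_x; elim: n => [|n IH] nN near_n beta_r.
  by rewrite /inner_iterate !big_geq// addr0 mulr0 subr0.
have {}IH : `|inner_iterate y beta v k n - z| ^+ 2
    <= `|y k - z| ^+ 2 - r * \sum_(1 <= i < n.+1) beta k i.
  apply: IH => [|i /ltnW|i /andP[i1 i_n]]; first exact: ltnW.
  - exact: near_n.
  - by rewrite beta_r// i1 leqW.
rewrite inner_iterateS big_nat_recr//= mulrDr.
have near_u := near_n n (ltnSn n).
set u := inner_iterate y beta v k n in IH near_u *.
have [su vD _] := v_def nN; rewrite -/u in su vD.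
have phi_u : `|phi x - phi u| < delta / 2 by apply: near_x; lra.
(* [z] has a smaller value than [u], so [u] does not minimize [phi] and the step is not the null
   one. *)
have D0 : ~ subdifferential dot phi u 0.
  move=> /(_ z); rewrite linear0l.
  by move: phi_u; rewrite ltr_norml => /andP[_]; lra.
have near_uh h : `|h| <= r -> phi (u + h) <= phi u + delta.
  move=> hr; have : `|phi x - phi (u + h)| < delta / 2.
    by apply: near_x; rewrite opprD addrA; have := ler_normB (x - u) h; lra.
  by move: phi_u; rewrite !ltr_norml => /andP[_ h1] /andP[h2 _]; lra.
have zu : phi z + delta <= phi u.
  by move: phi_u; rewrite !ltr_norml => /andP[_ h1]; lra.
have desc := normalized_subgradient_descent su r0 delta0 zu near_uh.
have := @descent_step u (v k n.+1) z (beta k n.+1) r.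
rewrite beta_r ?ltnSn// ltW ?beta_gt0// direction_norm_le1// => /(_ isT isT).
rewrite vD// linearNl lerN2 => /(_ desc); move: IH; lra.
Qed.

End Superiorization.

(** * Strong convergence and the dichotomy for the limit *)

Theorem corollary5p6 (R : realType) (H : completeNormedModType R)
  (dot : {dot H for idfun})
  (dot_norm : forall x : H, dot x x = `|x| ^+ 2)
  (phi : H -> R)
  (phi_convex : convex_function setT phi)
  (phi_cont : continuous phi)
  (m : nat) (m_gt0 : (0 < m)%N)
  (alpha : 'I_m -> R)
  (alpha_itv : forall i, 0 < alpha i <= 2)
  (U : 'I_m -> H -> H)
  (U_rfne : forall i, relaxed_firmly_nonexpansive dot (alpha i) (U i))
  (q : nat -> nat)
  (q_gt0 : forall k, (0 < q k)%N)
  (q_bounded : has_ubound (range q))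
  (Omega : forall k, {set {ffun 'I_(q k) -> 'I_m}})
  (Omega_neq0 : forall k, Omega k != finset.set0)
  (omega : forall k, {ffun 'I_(q k) -> 'I_m} -> R)
  (omega_itv : forall k t, t \in Omega k -> 0 < omega k t <= 1)
  (omega_sum : forall k, \sum_(t in Omega k) omega k t = 1) :
  let T := fun k => string_average U (Omega k) (omega k) in
  let I := limsup_ops T in
  let C := \bigcap_(S in I) Fix S in
  let Cmin := argmin phi C in
  forall (y0 : H)
    (T_admissible : limsup_admissible T)
    (T_shrinking : forall S, I S -> approximately_shrinking S)
    (Fix_regular : boundedly_regular I Fix)
    (N : nat -> nat)
    (N_gt0 : forall k, (0 < N k)%N)
    (beta : nat -> nat -> R)
    (beta_gt0 : forall k n, (1 <= n <= N k)%N -> 0 < beta k n)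
    (beta_summable : cvgn (series (fun k => \sum_(1 <= n < (N k).+1) beta k n)))
    (eps : R)
    (eps_gt0 : 0 < eps)
    (lambda : nat -> R)
    (lambda_gt0 : forall k, 0 < lambda k)
    (lambda_itv : forall k, eps <= lambda k <= 1 + rho_U alpha q - eps)
    (y : nat -> H)
    (y_generated : superiorized_sequence dot phi T N lambda beta y0 y),
  exists ystar : H,
    [/\ y k @[k --> \oo] --> ystar,
        C ystar &
        let alt1 := Cmin ystar in
        let alt2 := ~ Cmin ystar /\
                    exists k0, strictly_Fejer_from k0 y Cmin in
        (alt1 \/ alt2) /\ ~ (alt1 /\ alt2)].
Proof.
move=> T I C Cmin y0 T_adm T_shr Fix_reg N N0 beta beta0 cb eps eps0 lambda _.
move=> lambda_bnd y [_ [v [s [v_def y_def]]]].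
set rho := rho_U alpha q in lambda_bnd.
have rho0 : 0 <= rho by exact: rho_U_ge0.
have rho1 : rho <= 1 by rewrite /rho /rho_U ge_min lexx orbT.
have T_coc k : displacement_cocoercive dot rho (T k).
  by apply: string_average_rho_U => // t tO; have /andP[/ltW] := omega_itv k t tO.
(* Admissibility puts every [T k] in [I], so [C] lies in each of their fixed point sets. *)
have CT k z : C z -> T k z = z by move=> /(_ _ (T_adm.1 k)).
pose b k := \sum_(1 <= n < (N k).+1) beta k n.
pose w k := inner_iterate y beta v k (N k).
(* Strict positivity, from the first inner step, later makes the decrements [u k] positive. *)
have b0 k : 0 < b k.
  have N1 : (1 <= 1 <= N k)%N by rewrite N0.
  by apply: lt_le_trans (beta_le_sum beta0 N1); exact: beta0.
have b0' k := ltW (b0 k).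
have wy k : `|w k - y k| <= b k by exact: (inner_iterate_dist_le beta0 v_def).
have key z k : C z ->
    `|y k.+1 - z| ^+ 2 <= `|w k - z| ^+ 2 - eps ^+ 2 * `|T k (w k) - w k| ^+ 2.
  move=> /CT Tz; have /andP[l1 l2] := lambda_bnd k.
  have l0 : 0 <= lambda k by apply: le_trans l1; exact: ltW.
  rewrite y_def; apply: le_trans (relaxation_step_le dot_norm _ l0 (T_coc k) (Tz k)) _.
  rewrite lerD2l lerN2 ler_wpM2r ?sqr_ge0// expr2.
  (* Both [lambda k] and [1 + rho - lambda k] are at least [eps]. *)
  by apply: ler_pM => //; [exact: ltW|exact: ltW|lra].
have wyz z k : `|w k - z| <= `|y k - z| + b k.
  by have := ler_distD (y k) (w k) z; have := wy k; lra.
have ywz z k : C z -> `|y k.+1 - z| <= `|w k - z|.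
  move=> /(key z k) h; rewrite -(@ler_pXn2r _ 2)// ?nnegrE//.
  by apply: le_trans h _; rewrite gerBl mulr_ge0 ?sqr_ge0.
have fej z : C z -> forall k, `|y k.+1 - z| <= `|y k - z| + b k.
  by move=> Cz k; exact: le_trans (ywz _ _ Cz) _.
have [_ Fix_ccv [z0 Cz0] Fix_dist] := Fix_reg.
have r0 : `|T k (w k) - w k| @[k --> \oo] --> (0 : R).
  apply: (@quasi_fejer_residual_cvg0 _ (fun k => `|y k - z0|) b _ (eps ^+ 2)) => //.
    by rewrite exprn_gt0.
  move=> k; apply: le_trans (key z0 k Cz0) _.
  by rewrite lerD2r ler_pXn2r ?nnegrE ?addr_ge0.
have b_0 : b k @[k --> \oo] --> (0 : R) := cvg_series_cvg_0 cb.
have wy0 : `|w k - y k| @[k --> \oo] --> (0 : R).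
  by apply: (squeeze_cvgr _ (cvg_cst 0) b_0); near=> k; rewrite normr_ge0 wy.
have yw0 : `|y k.+1 - w k| @[k --> \oo] --> (0 : R).
  (* The factor 2 bounds [lambda k], since [rho <= 1]. *)
  have r20 : 2 * `|T k (w k) - w k| @[k --> \oo] --> (0 : R).
    by rewrite -[0](mulr0 2); apply: cvgM r0; exact: cvg_cst.
  apply: (squeeze_cvgr _ (cvg_cst 0) r20); near=> k.
  have /andP[l1 l2] := lambda_bnd k.
  rewrite normr_ge0 y_def addrAC subrr add0r normrZ /= ler_wpM2r//.
  by rewrite ger0_norm; lra.
have y_bnd : bounded_fun y.
  exists (`|z0| + `|y 0%N - z0| + limn (series b)); split; first exact: num_real.
  move=> M M_gt k _ /=; apply: le_trans (ltW M_gt).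
  have := quasi_fejer_le (fej z0 Cz0) (leq0n k).
  have := series_le_lim b0' cb k.
  have -> : series b 0%N = 0 by rewrite /series /= big_geq.
  have := ler_normD (y k - z0) z0; rewrite subrK; lra.
have dC : dist_to C (y k) @[k --> \oo] --> 0%E.
  apply: Fix_dist => // S IS; apply: (T_shr S IS).2 => //.
  have [M _ rec] := T_adm.2 S IS.
  apply: (recurrent_residual_cvg0 _ rec r0 wy0 yw0) => x z.
  have [j _ ->] := rec 0%N.
  exact: displacement_cocoercive_nonexpansive (T_coc j).
have clC : closed C by apply: closed_bigI => S /Fix_ccv[].
have [x Cx yx] := quasi_fejer_strong_cvg clC b0' cb fej dC.
exists x; split => //.
have [xmin|xmin] := pselect (Cmin x); first by split; [left|move=> [_ []]].
split; last by case.
right; split=> //.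
(* With no minimizer the Fejér inequality is vacuous, and any positive sequence serves. *)
have [[z1 [Cz1 z1min]]|noCmin] := pselect (exists z, Cmin z); last first.
  by exists 0%N, (fun=> 1) => // z Cz; case: noCmin; exists z.
have z1x : phi z1 < phi x.
  rewrite ltNge; apply/negP => xz1; apply: xmin; split=> // u Cu.
  exact: le_trans xz1 (z1min u Cu).
(* All minimizers share the value [phi z1], so [delta], and then [r] and [K], do not depend on the
   minimizer. *)
pose delta := (phi x - phi z1) / 2.
have delta0 : 0 < delta by rewrite divr_gt0// subr_gt0.
have delta20 : 0 < delta / 2 by rewrite divr_gt0.
have : nbhs x [set u | `|phi x - phi u| < delta / 2].
  exact: (cvgrPdist_lt _ _).1 (phi_cont x) _ delta20.
move=> /nbhs_ballP[e /= e0 near_x].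
pose r := e / 2.
have r0' : 0 < r by rewrite divr_gt0.
have r20 : 0 < r / 2 by rewrite divr_gt0.
(* One half of [r] is for [|x - y k|], the other for the total perturbation [b k]; all inner
   iterates then lie within [r] of [x]. *)
have [K _ HK] := filterI ((cvgrPdist_lt _ _).1 yx _ r20) (cvgr_lt _ b_0 _ r20).
exists K, (fun k => r * b k) => [k _|z [Cz zmin] k /HK /= [yxk bk]].
  by rewrite mulr_gt0.
(* The operator step does not increase the distance to [z], so the whole decrease [r * b k] comes
   from the perturbation. *)
apply: le_trans (_ : `|w k - z| ^+ 2 <= _).
  by rewrite ler_pXn2r ?nnegrE ?ywz.
apply: (inner_descent dot_norm beta0 v_def (x := x) (delta := delta)) => //.
- have : phi z = phi z1 by apply/eqP; rewrite eq_le zmin ?z1min.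
  by move=> ->; rewrite /delta; field.
- by move=> u xu; apply: near_x; rewrite -ball_normE /=; move: xu; rewrite /r; lra.
- move=> i /ltnW iN; have := inner_iterate_dist_le beta0 v_def iN.
  rewrite -/(b k) (distrC (inner_iterate _ _ _ _ _)).
  have := ler_distD (y k) x (inner_iterate y beta v k i); lra.
- by move=> i iN; have := beta_le_sum beta0 iN; rewrite -/(b k); lra.
Unshelve. all: by end_near. Qed.
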